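(* Let $H$ be a simple hypergraph. Then $|\lambda|\leq \Delta(H)$ for every eigenvalue $\lambda$ of the unified matrix $\mathbf{U}(H)$.
   Context: A hypergraph $H$ consists of a finite non-empty vertex set $V(H)$ and a multiset $E(H)$ of non-empty subsets of $V(H)$, called edges. It is simple if it has no loops (edges of cardinality one) and no multiple edges. The degree of a vertex $v$ is the number of edges containing $v$, and $\Delta(H)$ is the maximum of the degrees of the vertices of $H$. A 2-partition of a set $e$ is an unordered pair $\{S,S'\}$ of non-empty disjoint sets with $S\cup S'=e$; $S$ and $S'$ are called parts of $e$. $I(H)$ is the set of all parts of all edges of $H$ together with all singleton subsets of $V(H)$. For simple $H$, the unified matrix $\mathbf{U}(H)$ is the matrix indexed by $I(H)$ whose $(S,S')$ entry is $1$ if $\{S,S'\}$ is a 2-partition of an edge of $H$, and $0$ otherwise. *)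

(* Defs.v *)
From HB Require Import structures.
From mathcomp Require Import all_boot all_order all_algebra.
From mathcomp Require Import finmap multiset.

Set Implicit Arguments.
Unset Strict Implicit.
Unset Printing Implicit Defensive.

Import Order.TTheory GRing.Theory Num.Theory.

Record hypergraph (V : finType) := Hypergraph {
  edges : {mset {set V}}%mset;
  vertices_nonempty : 0 < #|V|;
  edges_nonempty : forall e : {set V}, e \in edges -> e != set0
}.

Section Hypergraph.

Variables (V : finType) (H : hypergraph V).

Definition simple_hypergraph : Prop :=
  forall e : {set V}, e \in edges H -> #|e| != 1 /\ edges H e = 1.

(* [edges H e] is the multiplicity of [e], so multiple edges count with
   multiplicity. *)
Definition degree (v : V) : nat := \sum_(e : {set V} | v \in e) edges H e.

Definition max_degree : nat := \max_(v : V) degree v.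

(* An unordered pair {S, S'} is the set [set S; S'] of sets of vertices. *)
Definition is_2partition (e : {set V}) (P : {set {set V}}) : bool :=
  [exists S : {set V}, exists S' : {set V},
    [&& P == [set S; S'], S != set0, S' != set0,
        [disjoint S & S'] & S :|: S' == e]].

Definition is_part (e S : {set V}) : bool :=
  [exists P : {set {set V}}, is_2partition e P && (S \in P)].

Definition parts : {set {set V}} :=
  [set S : {set V} | [exists e : {set V}, (e \in edges H) && is_part e S]]
  :|: [set [set v] | v : V].

(* Rows and columns are indexed through the enumeration of [parts]. *)
Definition unified_matrix (F : nzRingType) : 'M[F]_#|parts| :=
  \matrix_(i, j)
    (if [exists e : {set V},
          (e \in edges H) && is_2partition e [set enum_val i; enum_val j]]
     then 1 else 0)%R.

End Hypergraph.

(* Main.v *)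
Require Import Defs.
From mathcomp Require Import all_boot all_order all_algebra.
From mathcomp Require Import finmap multiset.

(** The absolute row sums of a square matrix bound the modulus of its
    eigenvalues, so it suffices to bound by [max_degree H] the number of ones in
    each row of the unified matrix. The row of a part [S] has a one at [S']
    exactly when [S] and [S'] partition an edge, namely [S :|: S']. That edge
    determines [S'] as its complement of [S], and it contains any vertex [v]
    chosen in [S]; hence the row has at most as many ones as there are edges
    through [v]. *)

Import Order.TTheory GRing.Theory Num.Theory.

(** Eigenvectors are row vectors here, so row sums are controlled by the l1 norm:
    taking norms in [u *m A = lambda *: u] and summing over all coordinates gives
    [`|lambda| * |u|_1 <= c * |u|_1]. The l1 norm also avoids choosing a
    coordinate of largest modulus, the order on [F] being only partial. *)
Lemma eigenvalue_norm_le_row_sum (F : numFieldType) (n : nat) (A : 'M[F]_n)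
    (c lambda : F) :
  (forall i, \sum_j `|A i j| <= c)%R -> eigenvalue A lambda ->
  (`|lambda| <= c)%R.
Proof.
move=> row_le /eigenvalueP[u uA u_neq0].
have u_gt0 : (0 < \sum_j `|u ord0 j|)%R.
  rewrite lt_neqAle sumr_ge0 // andbT eq_sym psumr_eq0 //.
  apply: contraNN u_neq0 => /allP u0; apply/eqP/rowP => j.
  by rewrite mxE; apply/eqP; rewrite -normr_eq0; apply: u0; rewrite mem_index_enum.
rewrite -(ler_pM2r u_gt0) mulr_sumr.
apply: (@le_trans _ _ (\sum_j \sum_i `|u ord0 i| * `|A i j|)%R).
  apply: ler_sum => j _.
  have /rowP/(_ j) := uA; rewrite !mxE -normrM => <-.
  apply: le_trans (ler_norm_sum _ _ _) _.
  by apply: ler_sum => i _; rewrite normrM.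
rewrite exchange_big mulr_sumr; apply: ler_sum => i _ /=.
by rewrite -mulr_sumr mulrC ler_wpM2r.
Qed.

Section UnifiedRows.

Variables (V : finType) (H : hypergraph V).

Definition complementary_in_edge (S T : {set V}) : bool :=
  [exists e : {set V}, (e \in edges H) && is_2partition e [set S; T]].

(** The definition of a 2-partition only provides some pair [S1], [S2] with
    [[set S; T] = [set S1; S2]]. As [S1] and [S2] are disjoint and non-empty they
    differ, so [S] and [T] are these two sets in one order or the other. *)
Lemma complementary_in_edgeP (S T : {set V}) : complementary_in_edge S T ->
  [/\ S != set0, [disjoint S & T] & S :|: T \in edges H].
Proof.
case/existsP=> e /andP[eH /existsP[S1 /existsP[S2 /and5P[/eqP ST nz1 nz2 dis]]]].
move/eqP=> eE; rewrite -eE in eH.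
have neq : S1 != S2.
  by apply: contraNneq nz1 => E; rewrite -E -setI_eq0 setIid in dis.
have ST_neq : S != T.
  apply: contraNneq neq => E; have := set21 S1 S2; have := set22 S1 S2.
  by rewrite -ST E setUid !inE => /eqP-> /eqP->.
move: (set21 S T) (set22 S T) ST_neq; rewrite ST !inE.
move=> /orP[]/eqP-> /orP[]/eqP->; rewrite ?eqxx // => _.
by rewrite disjoint_sym setUC.
Qed.

Lemma card_edges_le_degree (v : V) :
  #|[set e : {set V} | (v \in e) && (e \in edges H)]| <= degree H v.
Proof.
rewrite -sum1_card /degree (eq_bigl _ _ (in_set _)) big_mkcondr /=.
by apply: leq_sum => e _; case: ifP => //; rewrite in_mset.
Qed.

Lemma card_complementary_le_max_degree (S : {set V}) :
  #|[set T | complementary_in_edge S T]| <= max_degree H.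
Proof.
have [-> | [v vS]] := set_0Vmem S.
  rewrite (_ : [set T | _] = set0) ?cards0 //; apply/setP => T; rewrite !inE.
  by apply/negbTE/negP => /complementary_in_edgeP[]; rewrite eqxx.
apply: leq_trans (leq_bigmax v); apply: leq_trans (card_edges_le_degree v).
rewrite -(@card_in_imset _ _ (fun T => S :|: T)).
  apply/subset_leq_card/subsetP => e /imsetP[T]; rewrite inE.
  by case/complementary_in_edgeP=> _ _ eH ->; rewrite !inE vS.
move=> T1 T2; rewrite !inE => /complementary_in_edgeP[_ d1 _].
case/complementary_in_edgeP=> _ d2 _ /(congr1 (fun e => e :\: S)).
rewrite !setDUl !setDv !set0U !(setDidPl _) //; by rewrite disjoint_sym.
Qed.

Lemma unified_matrix_row_sum (F : numFieldType) (i : 'I_#|parts H|) :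
  (\sum_j `|unified_matrix H F i j| <= (max_degree H)%:R)%R.
Proof.
pose C : {set 'I_#|parts H|} :=
  [set j | complementary_in_edge (enum_val i) (enum_val j)].
have -> : (\sum_j `|unified_matrix H F i j| = #|C|%:R)%R.
  rewrite -[in RHS]sum1_card natr_sum [RHS]big_mkcond /=; apply: eq_bigr => j _.
  by rewrite mxE inE -/(complementary_in_edge _ _); case: ifP;
    rewrite ?normr1 ?normr0.
rewrite ler_nat -(card_imset C enum_val_inj).
apply: leq_trans (card_complementary_le_max_degree (enum_val i)).
by apply/subset_leq_card/subsetP => T /imsetP[j]; rewrite !inE => ? ->.
Qed.

End UnifiedRows.

(* F ranges over all numeric fields, hence covers both real and complex
   eigenvalues. *)
Theorem theorem9p2 (F : numFieldType) (V : finType) (H : hypergraph V)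
    (H_simple : simple_hypergraph H) (lambda : F)
    (H_eigen : eigenvalue (unified_matrix H F) lambda) :
  (`|lambda| <= (max_degree H)%:R)%R.
Proof.
exact: eigenvalue_norm_le_row_sum (unified_matrix_row_sum _ _ _) H_eigen.
Qed.
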